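(* There exist a separable Hilbert space $\mathcal H$, a bounded linear operator $T$ on $\mathcal H$, and non-trivial closed subspaces $\mathcal M_1,\mathcal M_2$ of $\mathcal H$ (that is, different from $\{0\}$ and from $\mathcal H$) such that $T$ is $\mathcal M_1$-hypercyclic and its adjoint $T^*$ is $\mathcal M_2$-hypercyclic.
   Context: For a bounded linear operator $T$ on a separable Hilbert space $\mathcal H$ and a closed subspace $\mathcal M$ of $\mathcal H$, $T$ is called $\mathcal M$-hypercyclic (subspace-hypercyclic for $\mathcal M$) if there exists $x\in\mathcal H$ such that $\{T^nx:n\ge 0\}\cap\mathcal M$ is dense in $\mathcal M$. *)

(* Defs.v *)
From HB Require Import structures.
From mathcomp Require Import all_boot all_order all_algebra.
From mathcomp Require Import all_classical all_reals all_analysis.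
From mathcomp Require Import complex.

Set Implicit Arguments.
Unset Strict Implicit.
Unset Printing Implicit Defensive.

Import Order.TTheory GRing.Theory Num.Theory.
Import numFieldNormedType.Exports.

Local Open Scope classical_set_scope.
Local Open Scope ring_scope.

(* With [H] a complete normed module over [C], this says that [H] is a Hilbert
   space with inner product [ip], linear in the first argument and
   conjugate-linear in the second. *)
Definition hilbert_dot (C : numClosedFieldType) (H : completeNormedModType C)
    (ip : {dot H for Num.conj}) : Prop :=
  forall x : H, ip x x = `|x| ^+ 2.

Definition separable (X : topologicalType) : Prop :=
  exists2 D : set X, countable D & dense D.

Definition bounded_operator (C : numFieldType) (H : normedModType C)
    (T : {linear H -> H}) : Prop :=
  exists r : C, forall x : H, `|T x| <= r * `|x|.

(* [S] is unique when it exists, by definiteness of [ip]. *)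
Definition is_adjoint (C : numClosedFieldType) (H : completeNormedModType C)
    (ip : {dot H for Num.conj}) (T S : {linear H -> H}) : Prop :=
  forall x y : H, ip (T x) y = ip x (S y).

Definition closed_subspace (C : numFieldType) (H : normedModType C)
    (M : set H) : Prop :=
  submod_closed (mem M) /\ closed M.

Definition nontrivial_closed_subspace (C : numFieldType) (H : normedModType C)
    (M : set H) : Prop :=
  [/\ closed_subspace M, M <> [set 0] & M <> setT].

Definition orbit_of (X : Type) (T : X -> X) (x : X) : set X :=
  range (fun n : nat => iter n T x).

(* Since the intersection is contained in [M], being dense in [M] for the
   subspace topology amounts to its closure in the whole space containing [M]. *)
Definition subspace_hypercyclic (C : numFieldType) (H : normedModType C)
    (T : {linear H -> H}) (M : set H) : Prop :=
  exists x : H, M `<=` closure (orbit_of T x `&` M).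

(* Main.v *)
Require Import Defs.
From HB Require Import structures.
From mathcomp Require Import all_boot all_order all_algebra.
From mathcomp Require Import all_classical all_reals all_analysis.
From mathcomp Require Import complex.
From mathcomp Require Import ring.

Set Implicit Arguments.
Unset Strict Implicit.
Unset Printing Implicit Defensive.

Import Order.TTheory GRing.Theory Num.Theory.
Import numFieldNormedType.Exports.

Local Open Scope classical_set_scope.
Local Open Scope ring_scope.

(* On [l2(nat)] let [T] be [2B] on the even coordinates and [2S] on the odd ones,
   where [B] and [S] are the backward and forward unilateral shifts.  Its adjoint
   is [2S] on the even coordinates and [2B] on the odd ones.  By Rolewicz, [2B]
   is hypercyclic, so [T] and its adjoint are subspace-hypercyclic for the
   subspaces of sequences supported on the even, resp. odd, coordinates.

   Of the scalar field only completeness, the convergence of bounded monotone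
   sequences and the existence of a dense sequence matter, so [l2(nat)] is taken
   over any [numClosedFieldType] with these properties. *)

(** * A hypercyclicity criterion *)

(** By the pigeonhole principle: [K.+1] distinct values cannot all lie below [K]. It supplies
    arbitrarily late indices of one and the same vector in an enumeration with repetitions. *)
Lemma injective_unbounded (h : nat -> nat) K :
  injective h -> exists m, (K <= h m)%N.
Proof.
move=> h_inj; apply: contrapT => /forallNP hK.
have : (size (map h (iota 0 K.+1)) <= size (iota 0 K))%N.
  apply: uniq_leq_size; first by rewrite map_inj_uniq ?iota_uniq.
  move=> _ /mapP[m _ ->]; rewrite mem_iota add0n /= ltnNge.
  exact/negP/hK.
by rewrite size_map !size_iota ltnn.
Qed.

Section HypercyclicityCriterion.
Variables (C : numFieldType) (H : completeNormedModType C).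
(** An Archimedean property: a general [numFieldType] may contain infinitesimals. *)
Hypothesis half_pow_small : forall e : C, 0 < e -> exists n, 2^-1 ^+ n < e.
Variables (T S : {linear H -> H}) (M : set H).
Hypothesis T_bounded : bounded_operator T.
Hypothesis M_closed : closed_subspace M.
Hypothesis S_stable : forall v, M v -> M (S v).
Hypothesis TS : forall v, M v -> T (S v) = v.
Hypothesis S_half : forall v, M v -> `|S v| <= 2^-1 * `|v|.
Variable y : nat -> H.
Hypothesis yM : forall k, M (y k).
Hypothesis y_killed : forall k, exists n, iter n T (y k) = 0.
(** The index must be available beyond any [K], because the orbit will approach [y k] only up to
    [2^-k]. *)
Hypothesis y_dense : forall v e K, M v -> 0 < e ->
  exists2 k, (K <= k)%N & `|v - y k| < e.

Local Notation half := (2^-1 : C).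

Lemma half_ge0 n : 0 <= half ^+ n.
Proof. by rewrite exprn_ge0// invr_ge0 ler0n. Qed.

Lemma half_le n m : (m <= n)%N -> half ^+ n <= half ^+ m.
Proof.
move=> mn; rewrite ler_wiXn2l// ?invr_ge0 ?ler0n// invf_le1 ?ltr0n// ler1n//.
Qed.

(** For [n <= m] the sum telescopes to exactly [2 * half ^+ n - 2 * half ^+ m]. *)
Lemma half_sum n m : \sum_(n <= k < m) half ^+ k <= 2 * half ^+ n.
Proof.
have [nm|/ltnW mn] := leqP n m; last first.
  by rewrite big_geq// mulr_ge0 ?half_ge0 ?ler0n.
suff -> : \sum_(n <= k < m) half ^+ k = 2 * half ^+ n - 2 * half ^+ m.
  by rewrite lerBlDr lerDl mulr_ge0 ?half_ge0 ?ler0n.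
elim: m nm => [|m IH]; first by rewrite leqn0 => /eqP->; rewrite big_geq// subrr.
rewrite leq_eqVlt => /predU1P[<-|]; first by rewrite big_geq// subrr.
rewrite ltnS => nm; rewrite big_nat_recr//= IH// exprS mulVKf ?pnatr_eq0//.
by ring.
Qed.

Lemma subspace0 : M 0.
Proof. by have [[/= + _] _] := M_closed; rewrite in_setE. Qed.

Lemma subspaceD u v : M u -> M v -> M (u + v).
Proof.
move=> Mu Mv; have [[_ lin] _] := M_closed.
by rewrite -[u]scale1r -in_setE; apply: lin; rewrite in_setE.
Qed.

Lemma subspace_sum (I : Type) (r : seq I) (P : pred I) (F : I -> H) :
  (forall i, M (F i)) -> M (\sum_(i <- r | P i) F i).
Proof.
by move=> MF; apply: big_ind => //; [exact: subspace0|exact: subspaceD].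
Qed.

Lemma iterS_stable n v : M v -> M (iter n S v).
Proof. by move=> Mv; elim: n => //= n; exact: S_stable. Qed.

Lemma iterTS n m v : M v -> (n <= m)%N ->
  iter n T (iter m S v) = iter (m - n) S v.
Proof.
move=> Mv; elim: n m => [|n IH] [|m]// nm.
by rewrite iterSr iterS TS; [rewrite subSS; exact: IH|exact: iterS_stable].
Qed.

Lemma iterS_norm n v : M v -> `|iter n S v| <= half ^+ n * `|v|.
Proof.
move=> Mv; elim: n => [|n IH] /=; first by rewrite expr0 mul1r.
apply: (le_trans (S_half (iterS_stable n Mv))).
by rewrite exprS -mulrA ler_pM2l// invr_gt0 ltr0n.
Qed.

Lemma iter_linear n : linear (iter n T).
Proof. by move=> a u v; elim: n => //= n ->; rewrite linearP. Qed.

Lemma iterTD n u v : iter n T (u + v) = iter n T u + iter n T v.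
Proof. by have := iter_linear n 1 u v; rewrite !scale1r. Qed.

Lemma iterT0 n : iter n T 0 = 0.
Proof. by elim: n => //= n ->; rewrite linear0. Qed.

Lemma iterT_sum n (r : seq nat) (F : nat -> H) :
  iter n T (\sum_(i <- r) F i) = \sum_(i <- r) iter n T (F i).
Proof.
elim: r => [|i r IH]; first by rewrite !big_nil iterT0.
by rewrite !big_cons iterTD IH.
Qed.

Lemma iterT_bounded n :
  exists2 r : C, 0 < r & forall v, `|iter n T v| <= r * `|v|.
Proof.
have [r Tr] := T_bounded.
(* [|r| + 1] is positive whatever [r] is; on the zero space the given [r] may even be negative. *)
have Tr' v : `|T v| <= (`|r| + 1) * `|v|.
  apply: (le_trans (Tr v)); have [v0|v0] := eqVneq v 0.
    by rewrite v0 normr0 !mulr0.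
  have r0 : 0 <= r.
    by rewrite -(@pmulr_lge0 _ `|v|) ?normr_gt0//; exact: le_trans (Tr v).
  by rewrite ler_pM2r ?normr_gt0// ger0_norm// lerDl.
have r1 : 0 < `|r| + 1 by rewrite ltr_wpDl.
exists ((`|r| + 1) ^+ n); first exact: exprn_gt0.
move=> v; elim: n => [|n IH] /=; first by rewrite expr0 mul1r.
by apply: (le_trans (Tr' _)); rewrite exprS -mulrA ler_pM2l.
Qed.

Lemma iterT_cvg n (u : nat -> H) l : u k @[k --> \oo] --> l ->
  iter n T (u k) @[k --> \oo] --> iter n T l.
Proof.
move=> ul; have [r r0 Tr] := iterT_bounded n.
apply/cvgrPdist_lt => e e0.
move/cvgrPdist_lt : ul => /(_ (e / r)); rewrite divr_gt0// => /(_ isT).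
apply: filterS => k; rewrite ltr_pdivlMr// mulrC; apply: le_lt_trans.
have -> : iter n T l - iter n T (u k) = iter n T (l - u k); last exact: Tr.
by apply/eqP; rewrite subr_eq -iterTD subrK.
Qed.

Lemma half_pow_scale_small (c e : C) : 0 <= c -> 0 < e ->
  exists n, half ^+ n * c <= e.
Proof.
move=> c0 e0; have c1 : 0 < c + 1 by rewrite ltr_wpDl.
have [n ne] := half_pow_small (divr_gt0 e0 c1).
exists n; apply: (@le_trans _ _ (half ^+ n * (c + 1))).
  by rewrite ler_wpM2l ?half_ge0// lerDl.
by rewrite -ler_pdivlMr// ltW.
Qed.

Lemma norm_half_sum (u : nat -> H) n m :
  (forall k, (n <= k)%N -> `|u k| <= half ^+ k) ->
  `|\sum_(n <= k < m) u k| <= 2 * half ^+ n.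
Proof.
move=> uk; apply: le_trans (half_sum n m); apply: (le_trans (ler_norm_sum _ _ _)).
by rewrite big_nat_cond [leRHS]big_nat_cond; apply: ler_sum => k /andP[/andP[/uk]].
Qed.

Lemma subspace_hypercyclic_criterion : subspace_hypercyclic T M.
Proof.
(* [N k] steps of [T] kill [y k]; [m k] steps of [S] shrink it to norm at most [2^-k]. *)
have [N yN] := choice y_killed.
have /choice[m ym] k : exists n, half ^+ n * `|y k| <= half ^+ k.
  by apply: half_pow_scale_small; rewrite ?exprn_gt0 ?invr_gt0 ?ltr0n.
(* The hypercyclic vector is [\sum_j S^(p j) (y j)].  The gaps of [p] are so large
   that [T^(p k) (S^(p j) (y j))] vanishes for [j < k] and has norm at most [2^-j]
   for [j > k]; for [j = k] it is [y k]. *)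
pose p k := (\sum_(i < k) (N i + m i.+1))%N.
have p_nd : {homo p : j k / (j <= k)%N >-> (j <= k)%N}.
  apply: homo_leq => // [? ? ?|k]; first exact: leq_trans.
  by rewrite /p big_ord_recr/= leq_addr.
have pN j k : (j < k)%N -> (p j + N j <= p k)%N.
  move=> jk; apply: leq_trans (p_nd _ _ jk).
  by rewrite /p big_ord_recr/= leq_add2l leq_addr.
have pm j k : (j < k)%N -> (p j + m k <= p k)%N.
  case: k => // k jk; rewrite {2}/p big_ord_recr/= -/(p k).
  by rewrite leq_add ?leq_addl// p_nd.
pose w j := iter (p j) S (y j).
have iterS_y k n : (n + m k <= p k)%N ->
    `|iter (p k - n) S (y k)| <= half ^+ k.
  move=> nk; apply: (le_trans (iterS_norm _ (yM k))); apply: le_trans (ym k).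
  by rewrite ler_wpM2r// half_le// leq_subRL// (leq_trans _ nk)// leq_addr.
(* [p 0 = 0], so [w 0] is [y 0] itself, of uncontrolled norm; only the later terms are small. *)
have w_small k : (0 < k)%N -> `|w k| <= half ^+ k.
  move=> k0; rewrite /w -[p k]subn0; apply: iterS_y.
  by rewrite (leq_trans _ (pm _ _ k0))// /p big_ord0.
have : cvgn (series w).
  apply/cauchy_cvgP/cauchy_seriesP => e e0.
  have [n ne] := half_pow_small (divr_gt0 e0 (ltr0n _ 2)).
  (* Only the left end [a] of a block of terms matters, since a block with [b <= a] is empty;
     [n < a] also keeps the index [0] out. *)
  exists ([set i | (n < i)%N], setT).
    by split; [exists n.+1 | exact: filterT].
  move=> [a b] /= [na _]; apply: (@le_lt_trans _ _ (2 * half ^+ a)).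
    apply: norm_half_sum => k ak; apply: w_small.
    by apply: leq_trans ak; exact: leq_ltn_trans na.
  rewrite mulrC -ltr_pdivlMr ?ltr0n//; apply: le_lt_trans ne; apply: half_le.
  exact: ltnW.
move=> wx; set x := lim _ in wx.
have Tw j k : (j < k)%N -> iter (p k) T (w j) = 0.
  move=> jk; have pjk := p_nd _ _ (ltnW jk).
  have Npk : (N j <= p k - p j)%N by rewrite leq_subRL// pN.
  rewrite -[p k](subnK pjk) iterD /w iterTS// subnn -[(_ - _)%N](subnK Npk).
  by rewrite iterD yN iterT0.
have Tx k K : (k < K)%N ->
    iter (p k) T (series w K) =
    y k + \sum_(k.+1 <= j < K) iter (p j - p k) S (y j).
  move=> kK; rewrite /series/= iterT_sum.
  rewrite (big_cat_nat (leq0n k) (ltnW kK))/=.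
  rewrite big_nat big1 ?add0r => [|j jk]; last exact: Tw.
  rewrite big_ltn// /w iterTS// subnn; congr (_ + _).
  by apply: eq_big_nat => j /andP[kj _]; rewrite iterTS// p_nd// ltnW.
have Tx_cvg k := @iterT_cvg (p k) _ _ wx.
(* By [Tx], the images of the late partial sums are sums of vectors [S^i (y j)], all in [M];
   closedness of [M] passes this to the limit. *)
have TxM k : M (iter (p k) T x).
  have [_ cM] := M_closed.
  have near_M : \forall K \near \oo, M (iter (p k) T (series w K)).
    exists k.+1 => // K /= kK; rewrite Tx//.
    by apply: subspaceD => //; apply: subspace_sum => j; exact: iterS_stable.
  apply: cM => B /(Tx_cvg k) xB.
  have [K [MK BK]] := filter_ex (filterI near_M xB).
  by exists (iter (p k) T (series w K)).
(* The terms beyond [k] sum to at most [2 * 2^-(k+1) = 2^-k]; the arbitrary [e] absorbs the passage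
   from partial sums to [x]. *)
have Txy k : `|iter (p k) T x - y k| <= half ^+ k.
  apply/ler_addgt0Pr => e e0; near \oo => K.
  have kK : (k < K)%N by near: K; exact: nbhs_infty_gt.
  have xK : `|iter (p k) T x - iter (p k) T (series w K)| < e.
    by near: K; move/cvgrPdist_lt : (Tx_cvg k); exact.
  rewrite -[iter _ _ x](subrK (iter (p k) T (series w K))) -addrA addrC.
  apply: (le_trans (ler_normD _ _)); rewrite lerD ?(ltW xK)// Tx// addrAC subrr.
  rewrite add0r; apply: (@le_trans _ _ (2 * half ^+ k.+1)).
    apply: norm_half_sum => j kj; apply: iterS_y.
    exact: pm.
  by rewrite exprS mulVKf// pnatr_eq0.
exists x => v Mv B /nbhs_ballP[e /= e0 vB].
have [n ne] := half_pow_small (divr_gt0 e0 (ltr0n _ 2)).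
have [k nk vk] := y_dense n Mv (divr_gt0 e0 (ltr0n _ 2)).
exists (iter (p k) T x); split; first by split => //; exists (p k).
apply: vB; rewrite -ball_normE /ball_/= [ltRHS]splitr.
rewrite -[v in v - _](subrK (y k)) -addrA; apply: (le_lt_trans (ler_normD _ _)).
rewrite ltrD// distrC (le_lt_trans (Txy k))// (le_lt_trans _ ne)//.
exact: half_le.
Unshelve. all: by end_near.
Qed.

End HypercyclicityCriterion.

(** * The Hilbert space of square-summable sequences *)

Section DotNorm.
Variables (C : numClosedFieldType) (U : lmodType C) (ip : {dot U for Num.conj}).

Lemma dot_ge0 (u : U) : 0 <= ip u u.
Proof.
have [->|/(@neq0_dnorm_gt0 _ _ _ ip)/ltW//] := eqVneq u 0.
by rewrite linear0r.
Qed.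

Lemma dot_eq0 (u : U) : ip u u = 0 -> u = 0.
Proof.
move=> u0; apply/eqP; apply: contraT => /(@neq0_dnorm_gt0 _ _ _ ip).
by rewrite u0 ltxx.
Qed.

Lemma dot_conj (u v : U) : ip u v = (ip v u)^*.
Proof. by rewrite [LHS]hermC /= expr0 mul1r. Qed.

(** Expand the nonnegative square of [ip v v *: u - ip u v *: v] and cancel the positive factor
    [ip v v]. *)
Lemma dot_CauchySchwarz (u v : U) : `|ip u v| ^+ 2 <= ip u u * ip v v.
Proof.
have [->|v0] := eqVneq v 0; first by rewrite !linear0r !normr0 expr0n.
have vv : 0 < ip v v by exact: neq0_dnorm_gt0.
have := dot_ge0 (ip v v *: u - ip u v *: v).
rewrite linearBl/= !linearBr/= !linearZl_LR/= !linearZr_LR/=.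
rewrite (geC0_conj (ltW vv)) -(dot_conj v u) normCK -(dot_conj v u).
set a := ip u u; set b := ip u v; set c := ip v u; set d := ip v v in vv *.
have scaleE (x y : C) : x *: (y : C^o) = x * y by [].
rewrite !scaleE (_ : _ - _ = d * (a * d - b * c)); last by ring.
by rewrite pmulr_rge0// subr_ge0.
Qed.

(** After squaring, the cross terms add up to twice the real part of [ip u v], which Cauchy-Schwarz
    bounds. *)
Lemma dot_triangle (u v : U) :
  sqrtC (ip (u + v) (u + v)) <= sqrtC (ip u u) + sqrtC (ip v v).
Proof.
have u0 : 0 <= sqrtC (ip u u) by rewrite sqrtC_ge0 dot_ge0.
have v0 : 0 <= sqrtC (ip v v) by rewrite sqrtC_ge0 dot_ge0.
rewrite -(@ler_pXn2r _ 2%N)// ?nnegrE ?sqrtC_ge0 ?dot_ge0 ?addr_ge0//.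
rewrite sqrrD !sqrtCK linearDl/= !linearDr/= (dot_conj v u).
rewrite (_ : ip u u + _ + _ =
  ip u u + (ip u v + (ip u v)^*) + ip v v); last by ring.
rewrite lerD2r lerD2l.
have -> : ip u v + (ip u v)^* = 'Re (ip u v) *+ 2.
  by rewrite ReE -mulr_natr divfK// pnatr_eq0.
rewrite lerMn2r/=; apply: (le_trans (leif_Re_Creal _)).
rewrite -(@ler_pXn2r _ 2%N)// ?nnegrE ?mulr_ge0//.
by rewrite exprMn !sqrtCK dot_CauchySchwarz.
Qed.

End DotNorm.

(** * The vector space of square-summable sequences *)

Section SquareSummable.
Variable C : numClosedFieldType.

Definition sqsum (f : nat -> C) n := \sum_(k < n) `|f k| ^+ 2.

(** Boolean through classical reflection, so that the submodule and subtype constructions apply. *)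
Definition sqsummable : {pred nat -> C} :=
  fun f => `[< exists M, forall n, sqsum f n <= M >].

Lemma sqsummableP f :
  reflect (exists M, forall n, sqsum f n <= M) (f \in sqsummable).
Proof. exact: asboolP. Qed.

(** The parallelogram identity, with the square of [|a - b|] dropped. *)
Lemma sqnormD_le (a b : C) : `|a + b| ^+ 2 <= `|a| ^+ 2 *+ 2 + `|b| ^+ 2 *+ 2.
Proof.
have -> : `|a| ^+ 2 *+ 2 + `|b| ^+ 2 *+ 2 = `|a + b| ^+ 2 + `|a - b| ^+ 2.
  by rewrite !normCK rmorphB rmorphD /=; ring.
by rewrite lerDl exprn_ge0.
Qed.

Lemma sqsummable_submod : submod_closed sqsummable.
Proof.
split=> [|a u v /sqsummableP[M uM] /sqsummableP[N vN]]; apply/sqsummableP.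
  by exists 0 => n; rewrite /sqsum big1// => i _; rewrite normr0 expr0n.
exists ((`|a| ^+ 2 * M) *+ 2 + N *+ 2) => n.
apply: (@le_trans _ _ ((`|a| ^+ 2 * sqsum u n) *+ 2 + sqsum v n *+ 2)).
  rewrite /sqsum mulr_sumr -!sumrMnl -big_split/=; apply: ler_sum => i _.
  by rewrite -exprMn -normrM; exact: sqnormD_le.
by rewrite lerD// lerMn2r/= ?ler_wpM2l// exprn_ge0.
Qed.

HB.instance Definition _ :=
  GRing.isSubmodClosed.Build C (nat -> C) sqsummable sqsummable_submod.

Record l2 := L2 { l2fun :> nat -> C; _ : l2fun \in sqsummable }.

HB.instance Definition _ := [isSub for l2fun].
HB.instance Definition _ := [Choice of l2 by <:].
HB.instance Definition _ := [SubChoice_isSubLmodule of l2 by <:].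

Lemma l2P (f : l2) : (f : nat -> C) \in sqsummable. Proof. exact: valP. Qed.
Lemma l2D (f g : l2) k : (f + g) k = f k + g k. Proof. by []. Qed.
Lemma l2B (f g : l2) k : (f - g) k = f k - g k. Proof. by []. Qed.
Lemma l2Z a (f : l2) k : (a *: f) k = a * f k. Proof. by []. Qed.
End SquareSummable.

(** * Limits and the partial order of the scalars *)

Section NumClosedLimits.
Variables (C : numClosedFieldType) (T : Type) (F : set_system T).
Context {FF : ProperFilter F}.
Implicit Types (u v : T -> C) (l a : C).

Lemma cvgC_unique u a l : u x @[x --> F] --> a -> u x @[x --> F] --> l -> a = l.
Proof. exact: (@cvg_unique C (@norm_hausdorff C C) _ (fmap_proper_filter u FF)). Qed.

(** The order is only partial, but [0 <= l] amounts to [l = |l|], an equation that passes to limits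
    by continuity of the norm. *)
Lemma cvg_ge0C u l : u x @[x --> F] --> l -> (\forall x \near F, 0 <= u x) ->
  0 <= l.
Proof.
move=> ul u0; suff -> : l = `|l| by [].
have nu : {near F, (fun x => `|u x|) =1 u}.
  by apply: (filterS _ u0) => x ux /=; rewrite ger0_norm.
exact: (cvgC_unique ul (cvg_trans (near_eq_cvg nu) (cvg_norm ul))).
Qed.

Lemma cvg_leC u a l : u x @[x --> F] --> l -> (\forall x \near F, u x <= a) ->
  l <= a.
Proof.
move=> ul ua; rewrite -subr_ge0; apply: (@cvg_ge0C (fun x => a - u x)).
  by apply: cvgB => //; exact: cvg_cst.
by apply: (filterS _ ua) => x; rewrite subr_ge0.
Qed.

Lemma cvg_conjC u l : u x @[x --> F] --> l -> (u x)^* @[x --> F] --> l^*.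
Proof.
move=> ul; apply/cvgrPdist_lt => e e0.
move/cvgrPdist_lt : ul => /(_ e e0); apply: filterS => x.
by rewrite -rmorphB norm_conjC.
Qed.
End NumClosedLimits.

(** It writes a partial inner product through four nondecreasing sums of squares, so that
    convergence of the latter gives convergence of the former. *)
Lemma polarization (C : numClosedFieldType) (a b : C) : a * b^* =
  4^-1 * (`|a + b| ^+ 2 - `|a - b| ^+ 2
          + 'i * (`|a + 'i * b| ^+ 2 - `|a - 'i * b| ^+ 2)).
Proof.
apply: (canRL (mulKf _)); first by rewrite pnatr_eq0.
rewrite !normCK !rmorphB !rmorphD !rmorphM /= conjCi.
have := @sqrCi C; rewrite expr2 => ii; ring: ii.
Qed.

(** * Inner product, norm and completeness *)

Section SquareSummableHilbert.
Variable C : numClosedFieldType.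
Hypothesis monotone_cvg : forall u : nat -> C, (forall n, 0 <= u n) ->
  (forall n, u n <= u n.+1) -> (exists M, forall n, u n <= M) -> cvgn u.
Hypothesis C_complete : forall F : set_system C, ProperFilter F ->
  cauchy F -> cvg F.
Implicit Types f g h : l2 C.

(** [limn] is meaningful only for a convergent sequence; [l2_dot_cvg] shows that this one always
    converges. *)
Definition l2_dot f g : C := limn (fun n => \sum_(k < n) f k * (g k)^*).

Lemma sqsum_ge0 (u : nat -> C) n : 0 <= sqsum u n.
Proof. by apply: sumr_ge0 => k _; rewrite exprn_ge0. Qed.

Lemma sqsum_nd (u : nat -> C) : {homo sqsum u : m n / (m <= n)%N >-> m <= n}.
Proof.
apply: homo_leq => // [? ? ?|n]; first exact: le_trans.
by rewrite /sqsum big_ord_recr/= lerDl exprn_ge0.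
Qed.

Lemma sqsum_is_cvg f : cvgn (sqsum f).
Proof.
apply: monotone_cvg => [n|n|]; [exact: sqsum_ge0|exact: sqsum_nd|].
exact/sqsummableP/l2P.
Qed.

Lemma l2_dot_cvg f g : \sum_(k < n) f k * (g k)^* @[n --> \oo] --> l2_dot f g.
Proof.
suff : cvgn (fun n => \sum_(k < n) f k * (g k)^*) by [].
have -> : (fun n => \sum_(k < n) f k * (g k)^*) =
    (fun n => 4^-1 * (sqsum (f + g) n - sqsum (f - g) n
      + 'i * (sqsum (f + 'i *: g) n - sqsum (f - 'i *: g) n))).
  apply/funext => n; rewrite /sqsum -!sumrB mulr_sumr -big_split mulr_sumr.
  by apply: eq_bigr => k _; exact: polarization.
apply: is_cvgMr; apply: is_cvgD; first by apply: is_cvgB; exact: sqsum_is_cvg.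
by apply: is_cvgMr; apply: is_cvgB; exact: sqsum_is_cvg.
Qed.

Lemma l2_dotE f g l :
  \sum_(k < n) f k * (g k)^* @[n --> \oo] --> l -> l2_dot f g = l.
Proof. exact: (cvgC_unique (@l2_dot_cvg f g)). Qed.

Lemma l2_dotl g a f h : l2_dot (a *: f + h) g = a * l2_dot f g + l2_dot h g.
Proof.
apply: l2_dotE.
have -> : (fun n => \sum_(k < n) (a *: f + h : l2 C) k * (g k)^*) =
   (fun n => a * (\sum_(k < n) f k * (g k)^*) + \sum_(k < n) h k * (g k)^*).
  apply/funext => n; rewrite mulr_sumr -big_split/=.
  by apply: eq_bigr => k _; transitivity ((a * f k + h k) * (g k)^*); [|ring].
by apply: cvgD; [apply: cvgMr|]; exact: l2_dot_cvg.
Qed.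

Lemma l2_dot_conj f g : l2_dot f g = (l2_dot g f)^*.
Proof.
apply: l2_dotE.
have -> : (fun n => \sum_(k < n) f k * (g k)^*) =
    (fun n => (\sum_(k < n) g k * (f k)^*)^*).
  apply/funext => n; rewrite rmorph_sum/=.
  by apply: eq_bigr => k _; rewrite rmorphM /= conjCK mulrC.
by apply: cvg_conjC; exact: l2_dot_cvg.
Qed.

Lemma sqsum_cvg f : sqsum f n @[n --> \oo] --> l2_dot f f.
Proof.
have -> : sqsum f = (fun n => \sum_(k < n) f k * (f k)^*).
  by apply/funext => n; apply: eq_bigr => k _; rewrite normCK.
exact: l2_dot_cvg.
Qed.

Lemma sqsum_le_dot f n : sqsum f n <= l2_dot f f.
Proof.
rewrite -subr_ge0; apply: (@cvg_ge0C C nat \oo _ (fun m => sqsum f (m + n) - sqsum f n)).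
  apply: cvgB; last exact: cvg_cst.
  exact: (cvg_comp (addn^~ n) (sqsum f) (cvg_addnr n) (@sqsum_cvg f)).
by apply: nearW => m; rewrite subr_ge0 sqsum_nd// leq_addl.
Qed.

Lemma dot_le_sqsum f M : (forall n, sqsum f n <= M) -> l2_dot f f <= M.
Proof. by move=> fM; apply: cvg_leC (@sqsum_cvg f) _; exact: nearW. Qed.

Lemma sqr_coord_le_dot f k : `|f k| ^+ 2 <= l2_dot f f.
Proof.
apply: le_trans (sqsum_le_dot f k.+1).
by rewrite /sqsum big_ord_recr/= lerDr sqsum_ge0.
Qed.

Lemma l2_dot_gt0 f : f != 0 -> 0 < l2_dot f f.
Proof.
move=> f0; have : exists k, f k != 0.
  apply: contrapT => /forallNP fk0; move/eqP : f0; apply.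
  by apply/val_inj/funext => k; apply/eqP; have /negP := fk0 k; rewrite negbK.
by case=> k fk; apply: lt_le_trans (sqr_coord_le_dot f k);
  rewrite exprn_gt0 ?normr_gt0.
Qed.

Lemma l2_dot_bilinear : bilinear_for
  (GRing.Scale.Law.clone _ _ ( *%R ) _)
  (GRing.Scale.Law.clone _ _ (Num.conj \; *%R ) _) l2_dot.
Proof.
split=> [g|f] a u v /=; first exact: l2_dotl.
by rewrite l2_dot_conj l2_dotl rmorphD rmorphM /= -!l2_dot_conj.
Qed.

HB.instance Definition _ := bilinear_isBilinear.Build C (l2 C) (l2 C) C
  (GRing.Scale.Law.clone _ _ ( *%R ) _)
  (GRing.Scale.Law.clone _ _ (Num.conj \; *%R ) _) l2_dot l2_dot_bilinear.

Lemma l2_dot_hermitian f g : l2_dot f g = (-1) ^+ false * Num.conj (l2_dot g f).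
Proof. by rewrite expr0 mul1r; exact: l2_dot_conj. Qed.

HB.instance Definition _ := isHermitianSesquilinear.Build C (l2 C) false Num.conj
  l2_dot l2_dot_hermitian.
HB.instance Definition _ := isDotProduct.Build C (l2 C) l2_dot l2_dot_gt0.

Definition l2_norm f := sqrtC (l2_dot f f).

Lemma l2_normD f g : l2_norm (f + g) <= l2_norm f + l2_norm g.
Proof. exact: dot_triangle. Qed.

Lemma l2_normZ (a : C) f : l2_norm (a *: f) = `|a| * l2_norm f.
Proof.
rewrite /l2_norm linearZl_LR/= linearZr_LR/= mulrA -normCK.
by rewrite sqrtCM ?nnegrE ?exprn_ge0 ?dot_ge0// sqrCK.
Qed.

Lemma l2_norm_eq0 f : l2_norm f = 0 -> f = 0.
Proof. by move/eqP; rewrite sqrtC_eq0 => /eqP/dot_eq0. Qed.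

HB.instance Definition _ :=
  Lmodule_isNormed.Build C (l2 C) l2_normD l2_normZ l2_norm_eq0.

Lemma sqr_l2_norm f : `|f| ^+ 2 = l2_dot f f.
Proof. exact: sqrtCK. Qed.

Lemma coord_le_norm f k : `|f k| <= `|f|.
Proof.
by rewrite -(@ler_pXn2r _ 2%N)// ?nnegrE// sqr_l2_norm sqr_coord_le_dot.
Qed.

Lemma sqsum_le_norm f n : sqsum f n <= `|f| ^+ 2.
Proof. by rewrite sqr_l2_norm sqsum_le_dot. Qed.

Lemma norm_le_sqsum f M : 0 <= M -> (forall n, sqsum f n <= M ^+ 2) -> `|f| <= M.
Proof.
move=> M0 fM; rewrite -(@ler_pXn2r _ 2%N)// ?nnegrE//.
by rewrite sqr_l2_norm dot_le_sqsum.
Qed.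

(** Coordinates are dominated by the norm, hence converge. Their limit [a] is a limit in norm: in
    the Cauchy estimate for [f - g], fix [f] and a finite partial sum and let [g] run to the limit;
    the resulting bound is uniform in [n]. *)
Lemma l2_complete (F : set_system (l2 C)) : ProperFilter F -> cauchy F -> cvg F.
Proof.
move=> FF Fc.
have Fcauchy e : 0 < e -> \forall f & g \near F, `|f - g| < e.
  by move=> e0; move/cauchy_ballP : Fc => /(_ e e0); rewrite -ball_normE.
have coord_cvg : forall k, exists l : C, (f : l2 C) k @[f --> F] --> l.
  move=> k; exists (lim ((fun f : l2 C => f k) @ F)); apply: C_complete.
  apply/cauchy_ballP => e e0; rewrite -ball_normE.
  rewrite !near_simpl near_map2; have := Fcauchy e e0; apply: filterS => -[f g] /=.
  by apply: le_lt_trans; exact: (coord_le_norm (f - g)).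
have [a fa] := choice coord_cvg.

have key (e : C) : 0 < e -> \forall f \near F, forall n,
    \sum_(k < n) `|(f : l2 C) k - a k| ^+ 2 <= e ^+ 2.
  move=> e0; apply: (filterS _ (nearP_dep (Fcauchy e e0))) => f fg n.
  apply: (@cvg_leC C (l2 C) F FF (fun g => \sum_(k < n) `|f k - g k| ^+ 2)).
    apply: cvg_big => [|k _]; first exact: add_continuous.
    under eq_cvg do rewrite expr2.
    have fak : `|f k - (g : l2 C) k| @[g --> F] --> `|f k - a k|.
      by apply: cvg_norm; apply: cvgB; [exact: cvg_cst|exact: fa].
    by rewrite expr2; exact: cvgM.
  apply: (filterS _ fg) => g {}fg; apply: (le_trans (sqsum_le_norm (f - g) n)).
  by apply: lerXn2r; rewrite ?nnegrE ?(ltW e0) ?(ltW fg)// normr_ge0.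
(* The radius [1] gives one [f] in the space with [f - a] square-summable, hence so is [a]. *)
have [f f1] := filter_ex (key _ ltr01).
have fa_in : (fun k => f k - a k) \in @sqsummable C.
  by apply/sqsummableP; exists (1 ^+ 2).
have a_in : a \in @sqsummable C.
  rewrite (_ : a = l2fun (f - L2 fa_in)); first exact: l2P.
  by apply/funext => k; rewrite l2B/= opprB addrC subrK.
apply/cvg_ex; exists (L2 a_in); apply/cvgrPdist_le => e e0.
apply: (filterS _ (key e e0)) => g ge; rewrite distrC.
by apply: norm_le_sqsum; rewrite ?ltW.
Qed.

HB.instance Definition _ := Uniform_isComplete.Build (l2 C) l2_complete.

(** * The operator *)

(** The squared moduli are differences of consecutive partial sums of a convergent series. *)
Lemma coord_cvg0 f : f n @[n --> \oo] --> 0.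
Proof.
have d0 : sqsum f n.+1 - sqsum f n @[n --> \oo] --> 0.
  rewrite -(subrr (l2_dot f f)); apply: cvgB; last exact: sqsum_cvg.
  by rewrite (cvg_shiftS (sqsum f)); exact: sqsum_cvg.
apply/cvgrPdist_lt => e e0.
move/cvgrPdist_lt : d0 => /(_ (e ^+ 2)); rewrite exprn_gt0// => /(_ isT).
apply: filterS => n; rewrite !sub0r !normrN /sqsum big_ord_recr/= addrAC subrr add0r.
by rewrite normrX normr_id ltr_pXn2r// nnegrE ltW.
Qed.

Lemma cvg0_le (u v : nat -> C) : (forall n, `|u n| <= `|v n|) ->
  v n @[n --> \oo] --> 0 -> u n @[n --> \oo] --> 0.
Proof.
move=> uv v0; apply/cvgrPdist_lt => e e0.
move/cvgrPdist_lt : v0 => /(_ _ e0); apply: filterS => n.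
by rewrite !sub0r !normrN; exact: le_lt_trans.
Qed.

(* Twice the backward shift on the coordinates of parity [b], twice the forward
   shift on the others, so that the adjoint is [jump (~~ b)]. *)
Definition jump (b : bool) (u : nat -> C) (n : nat) : C :=
  if odd n == b then 2 * u n.+2 else if n is m.+2 then 2 * u m else 0.

(** Coordinate [k] of [jump b u] is [0] or twice coordinate [k + 2] or [k - 2] of [u], so its square
    is at most [4] times the sum of both squares; each of the two sums is at most [sqsum u n.+2]. *)
Lemma sqsum_jump b (u : nat -> C) n : sqsum (jump b u) n <= 8 * sqsum u n.+2.
Proof.
pose prev k := if k is m.+2 then `|u m| ^+ 2 else 0.
have prev0 k : 0 <= prev k by case: k => [|[|k]] //=; rewrite exprn_ge0.
have S1 : \sum_(k < n) `|u k.+2| ^+ 2 <= sqsum u n.+2.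
  rewrite /sqsum !big_ord_recl/= addrA lerDr.
  by rewrite addr_ge0// ?exprn_ge0.
have S2 : \sum_(k < n) prev k <= sqsum u n.+2.
  (* Extended to [n.+4] terms, the sum drops its two leading zeros and becomes [sqsum u n.+2]. *)
  apply: (@le_trans _ _ (\sum_(k < n.+4) prev k)).
    do 4 rewrite big_ord_recr/=; rewrite -!addrA lerDl.
    rewrite !addr_ge0 ?exprn_ge0 ?normr_ge0//.
    exact: (prev0 n.+1).
  by rewrite 2!big_ord_recl/= !add0r.
apply: (@le_trans _ _ (\sum_(k < n) (4 * `|u k.+2| ^+ 2 + 4 * prev k))).
  apply: ler_sum => -[k /= _] _; rewrite /jump /prev.
  case: eqP => _; last case: k => [|[|k]].
  - by rewrite normrM exprMn normr_nat -natrX lerDl; apply: mulr_ge0 => //; exact: (prev0 k).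
  - by rewrite normr0 expr0n mulr0 addr0 mulr_ge0// exprn_ge0.
  - by rewrite normr0 expr0n mulr0 addr0 mulr_ge0// exprn_ge0.
  by rewrite normrM exprMn normr_nat -natrX lerDr mulr_ge0// exprn_ge0.
rewrite big_split/= -!mulr_sumr (_ : 8 * _ = 4 * sqsum u n.+2 + 4 * sqsum u n.+2).
  by rewrite lerD// ler_pM2l.
by ring.
Qed.

Lemma jump_sqsummable b f : jump b f \in @sqsummable C.
Proof.
apply/sqsummableP; exists (8 * `|f| ^+ 2) => n.
by apply: (le_trans (sqsum_jump b f n)); rewrite ler_pM2l// sqsum_le_norm.
Qed.

Definition l2_jump b f : l2 C := L2 (jump_sqsummable b f).

Lemma l2_jump_linear b : linear (l2_jump b).
Proof.
move=> a f g; apply/val_inj/funext => n /=; rewrite /jump.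
transitivity (a * jump b f n + jump b g n); last by [].
rewrite /jump; case: eqP => _.
  by transitivity (2 * (a * f n.+2 + g n.+2)); [by []|ring].
case: n => [|[|n]]; rewrite ?mulr0 ?addr0//.
by transitivity (2 * (a * f n + g n)); [by []|ring].
Qed.

HB.instance Definition _ b :=
  GRing.isLinear.Build C (l2 C) (l2 C) *:%R (l2_jump b) (l2_jump_linear b).

Lemma l2_jump_bounded b : bounded_operator (l2_jump b).
Proof.
(* [3] works because [8 <= 3 ^+ 2]. *)
exists 3 => f; apply: norm_le_sqsum => [|n]; first by rewrite mulr_ge0.
apply: (le_trans (sqsum_jump b f n)); rewrite exprMn -natrX.
by rewrite ler_pM ?sqsum_ge0 ?sqsum_le_norm// ler_nat.
Qed.

Lemma cvg_shift2 (u : nat -> C) (l : C) :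
  u n @[n --> \oo] --> l -> u n.+2 @[n --> \oo] --> l.
Proof. by move=> ul; rewrite (cvg_shiftS (fun n => u n.+1)) (cvg_shiftS u). Qed.

(* The two partial sums up to [n.+2] differ only by the boundary terms
   [c n, c n.+1, d n, d n.+1], which tend to [0]. *)
Lemma l2_jump_adjoint b f g :
  l2_dot (l2_jump b f) g = l2_dot f (l2_jump (~~ b) g).
Proof.
(* [c k] pairs [f k.+2] with [g k] when [k] has parity [b], [d k] pairs [f k] with [g k.+2] at the
   other parity. Each occurs in both sums, at indices that differ by two. *)
pose c k := if odd k == b then 2 * f k.+2 * (g k)^* else 0.
pose d k := if odd k == b then 0 else 2 * f k * (g k.+2)^*.
have oddNb k : (odd k == ~~ b) = ~~ (odd k == b).
  by case: (odd k); case: (b).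
have fg k : l2_jump b f k.+2 * (g k.+2)^* = c k.+2 + d k.
  rewrite /= /jump /c /d /= negbK.
  by case: (odd k == b); rewrite ?addr0 ?add0r.
have gf k : f k.+2 * (l2_jump (~~ b) g k.+2)^* = d k.+2 + c k.
  rewrite /= /jump /c /d /= negbK oddNb.
  by case: (odd k == b) => /=; rewrite rmorphM rmorph_nat /=; ring.
pose A n := \sum_(k < n) l2_jump b f k * (g k)^*.
pose B n := \sum_(k < n) f k * (l2_jump (~~ b) g k)^*.
have AB n : A n.+2 - B n.+2 = c n + c n.+1 - d n - d n.+1.
  elim: n => [|n IH].
    rewrite /A /B !big_ord_recl !big_ord0 /= /jump /c /d !oddNb /=.
    by case: (b) => /=; rewrite ?rmorphM ?rmorph0 ?rmorph_nat /=; ring.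
  rewrite /A /B [X in X - _]big_ord_recr [X in _ - X]big_ord_recr /= -/(A _) -/(B _).
  by rewrite opprD addrACA IH fg gf; ring.
have f0 := @coord_cvg0 f.
have g0 : (g n)^* @[n --> \oo] --> (0 : C).
  by rewrite -conjC0; apply: cvg_conjC; exact: coord_cvg0.
have f2 := cvg_shift2 f0; have g2 := cvg_shift2 g0.
have c0 : c n @[n --> \oo] --> 0.
  apply: (@cvg0_le _ (fun n => 2 * f n.+2 * (g n)^*)) => [n|].
    by rewrite /c; case: ifP => // _; rewrite normr0.
  by rewrite -(mulr0 (2 * 0)); apply: cvgM => //; exact: cvgMr.
have d0 : d n @[n --> \oo] --> 0.
  apply: (@cvg0_le _ (fun n => 2 * f n * (g n.+2)^*)) => [n|].
    by rewrite /d; case: ifP => // _; rewrite normr0.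
  by rewrite -(mulr0 (2 * 0)); apply: cvgM => //; exact: cvgMr.
have c1 : c n.+1 @[n --> \oo] --> 0 by rewrite (cvg_shiftS c).
have d1 : d n.+1 @[n --> \oo] --> 0 by rewrite (cvg_shiftS d).
have AB0 : A n.+2 - B n.+2 @[n --> \oo] --> 0.
  rewrite (_ : (fun n => _) = (fun n => c n + c n.+1 - d n - d n.+1)); last first.
    exact/funext.
  have := cvgB (cvgB (cvgD c0 c1) d0) d1.
  by rewrite !subr0 addr0; apply.
have ABl : A n.+2 - B n.+2 @[n --> \oo] -->
    l2_dot (l2_jump b f) g - l2_dot f (l2_jump (~~ b) g).
  by apply: cvgB; apply: (@cvg_shift2 _ _); exact: l2_dot_cvg.
by apply/eqP; rewrite -subr_eq0; apply/eqP; exact: (cvgC_unique ABl AB0).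
Qed.

(** * The parity subspaces and a right inverse on them *)

Definition parity_subspace (b : bool) : set (l2 C) :=
  [set f | forall n, odd n != b -> f n = 0].

Lemma parity_subspace_closed b : closed_subspace (parity_subspace b).
Proof.
split; first split => [|a f g].
- by rewrite in_setE.
- rewrite !in_setE => fb gb n nb; rewrite l2D l2Z fb// gb// mulr0 addr0//.
move=> f fcl n nb; apply/eqP; rewrite -normr_le0; apply/ler_addgt0Pr => e e0.
have [g [gb]] := fcl _ (nbhsx_ballx f e e0).
rewrite -ball_normE /= => fg; rewrite add0r.
apply: le_trans (ltW fg); apply: le_trans (coord_le_norm (f - g) n).
by rewrite l2B gb// subr0.
Qed.

Lemma finite_sqsummable (s : seq C) : nth 0 s \in @sqsummable C.
Proof.
apply/sqsummableP; exists (sqsum (nth 0 s) (size s)) => n.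
apply: (@le_trans _ _ (sqsum (nth 0 s) (size s + n)%N)).
  by rewrite sqsum_nd// leq_addl.
rewrite {1}/sqsum big_split_ord/= [X in _ + X]big1 ?addr0// => k _.
by rewrite nth_default ?leq_addr// normr0 expr0n.
Qed.

Definition l2_of_seq (s : seq C) : l2 C := L2 (finite_sqsummable s).

Lemma parity_subspace_nontrivial b :
  nontrivial_closed_subspace (parity_subspace b).
Proof.
(* Unit vectors at [0] and [1]: one lies in the subspace, which is thus nonzero; the other does not,
   so the subspace is proper. *)
have [e0 e1] : (exists e : l2 C, e 0%N = 1 /\ forall n, odd n -> e n = 0) /\
    (exists e : l2 C, e 1%N = 1 /\ forall n, ~~ odd n -> e n = 0).
  split; [exists (l2_of_seq [:: 1])|exists (l2_of_seq [:: 0; 1])]; split => //.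
  - by case=> [|[]].
  - by case=> [|[|[]]].
split; first exact: parity_subspace_closed.
- move=> b0; have [e [k ek] eb] :
      exists2 e : l2 C, exists k, e k = 1 & parity_subspace b e.
    case: b b0 => _; [have [e [ek en]] := e1|have [e [ek en]] := e0].
      by exists e; [exists 1%N|move=> n nb; apply: en; move: nb; case: odd].
    by exists e; [exists 0%N|move=> n nb; apply: en; move: nb; case: odd].
  by move: eb ek; rewrite b0 => /= -> /eqP; rewrite eq_sym oner_eq0.
- move=> bT; case: b bT => bT.
    have [e [ek _]] := e0; have : parity_subspace true e by rewrite bT.
    by move/(_ 0%N isT); rewrite ek => /eqP; rewrite oner_eq0.
  have [e [ek _]] := e1; have : parity_subspace false e by rewrite bT.
  by move/(_ 1%N isT); rewrite ek => /eqP; rewrite oner_eq0.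
Qed.

Lemma l2_jump_stable b f :
  parity_subspace b f -> parity_subspace b (l2_jump b f).
Proof.
move=> fb n nb; rewrite /= /jump (negbTE nb).
by case: n nb => [|[|n]]//= nb; rewrite fb ?mulr0//; move: nb; rewrite negbK.
Qed.

(** On vectors of parity [b], [l2_jump b] undoes [l2_jump (~~ b)] up to the factor [4]; scaled by
    [quarter], the latter is a right inverse, namely half a forward shift. *)
Definition quarter : C := 4^-1.

Lemma l2_jumpN_stable b f :
  parity_subspace b f -> parity_subspace b (quarter *: l2_jump (~~ b) f).
Proof.
move=> fb n nb; rewrite -[LHS]/(quarter * jump (~~ b) f n) /jump.
have -> : odd n == ~~ b by move: nb; case: (odd n); case: (b).
by rewrite fb ?mulr0//= negbK.
Qed.

Lemma l2_jumpK b f : parity_subspace b f ->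
  l2_jump b (quarter *: l2_jump (~~ b) f) = f.
Proof.
move=> fb; apply/val_inj/funext => n; have := l2_jumpN_stable fb.
set g := _ *: _ => gb; rewrite -[LHS]/(jump b g n) -[RHS]/(f n) /jump.
have [nb|nb] := eqVneq (odd n) b.
  rewrite -[l2fun g _]/(quarter * jump (~~ b) f n.+2) /jump /= negbK nb.
  have -> : (b == ~~ b) = false by case: (b).
  by rewrite mulrCA [2 * (2 * _)]mulrA -natrM mulKf// pnatr_eq0.
case: n nb => [|[|n]] nb; rewrite fb// gb ?mulr0//.
by move: nb => /=; rewrite negbK.
Qed.

(** Moving one factor across by adjointness leaves [l2_jumpK], so the squared norm is a quarter of
    that of [f]. *)
Lemma l2_jumpN_norm b f : parity_subspace b f ->
  `|quarter *: l2_jump (~~ b) f| = 2^-1 * `|f|.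
Proof.
move=> fb; apply/eqP; rewrite -(@eqrXn2 _ 2%N)// ?mulr_ge0 ?invr_ge0 ?ler0n//.
rewrite exprMn !sqr_l2_norm linearZl_LR/= l2_jump_adjoint negbK l2_jumpK//.
by rewrite exprVn -natrX.
Qed.

(** On the subspace each application moves the support down by two; losing one index per step is
    enough for the induction. *)
Lemma l2_jump_nilpotent b K f : parity_subspace b f ->
  (forall k, (K <= k)%N -> f k = 0) -> iter K (l2_jump b) f = 0.
Proof.
elim: K f => [|K IH] f fb fK; first by apply/val_inj/funext => k; exact: fK.
rewrite iterSr; apply: IH; first exact: l2_jump_stable.
move=> k Kk; rewrite /= /jump; case: eqP => [_|/eqP kb].
  by rewrite fK ?mulr0// (leq_trans _ (leqnSn _)).
case: k Kk kb => [|[|k]]//= _ kb; rewrite fb ?mulr0//.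
by move: kb; rewrite negbK.
Qed.

(** * Separability and hypercyclicity *)

Hypothesis half_pow_small : forall e : C, 0 < e -> exists n, 2^-1 ^+ n < e.
Variable d : nat -> C.
Hypothesis d_dense : forall z e, 0 < e -> exists n, `|z - d n| < e.

(** Cut [f] off at [N] with squared tail below [r ^+ 2] and approximate the first [N] coordinates by
    values of [d]. As [r = e / 2], the squared error is at most [2 r^2 < e^2]. *)
Lemma l2_of_seq_dense f (e : C) : 0 < e ->
  exists s : seq nat, `|f - l2_of_seq (map d s)| < e.
Proof.
move=> e0; pose r := e / 2; have r0 : 0 < r by rewrite divr_gt0.
have [N fN] : exists N, l2_dot f f - sqsum f N < r ^+ 2.
  move/cvgrPdist_lt : (@sqsum_cvg f) => /(_ (r ^+ 2)).
  rewrite exprn_gt0// => /(_ isT) [N _ /(_ N (leqnn N)) fN]; exists N.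
  by apply: le_lt_trans fN; rewrite ger0_norm// subr_ge0 sqsum_le_dot.
(* [N.+1] avoids a zero denominator, and [N] squared errors still add up to at most [r ^+ 2]. *)
have rN : 0 < r / N.+1%:R by rewrite divr_gt0.
have [s fs] := choice (fun k => d_dense (f k) rN).
exists (mkseq s N); set g := l2_of_seq _.
have gE k : g k = if (k < N)%N then d (s k) else 0.
  rewrite /g /=; case: ltnP => kN; last by rewrite nth_default// size_map size_mkseq.
  by rewrite (nth_map 0%N) ?size_mkseq// nth_mkseq.
have fg n : sqsum (f - g) n <= r ^+ 2 + r ^+ 2.
  apply: (@le_trans _ _ (sqsum (f - g) (N + n))).
    by rewrite sqsum_nd// leq_addl.
  rewrite /sqsum big_split_ord /=; apply: lerD.
    apply: (@le_trans _ _ (\sum_(k < N) (r / N.+1%:R) ^+ 2)).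
      apply: ler_sum => k _; rewrite -[X in `|X|]/(f k - g k) gE ltn_ord.
      by apply: lerXn2r; rewrite ?nnegrE ?(ltW rN)// ltW.
    rewrite sumr_const card_ord -[leLHS]mulr_natr expr_div_n mulrAC.
    rewrite ler_pdivrMr ?exprn_gt0//.
    rewrite ler_wpM2l ?exprn_ge0 ?(ltW r0)// -natrX ler_nat.
    by rewrite (leq_trans (leqnSn N))// leq_pmulr.
  apply: le_trans (ltW fN); rewrite lerBrDr addrC.
  apply: le_trans (sqsum_le_dot f (N + n)); rewrite /sqsum big_split_ord /= lerD2l.
  apply: ler_sum => k _.
  rewrite -[X in `|X| ^+ 2 <= _]/(f (N + k)%N - g (N + k)%N).
  by rewrite gE ltnNge leq_addr /= subr0.
have r2e : r ^+ 2 + r ^+ 2 < e ^+ 2.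
  rewrite [ltRHS](_ : _ = (r ^+ 2 + r ^+ 2) + (r ^+ 2 + r ^+ 2)).
    by rewrite ltrDl addr_gt0// exprn_gt0.
  by rewrite [in LHS](splitr e) -/r; ring.
rewrite -(@ltr_pXn2r _ 2%N)// ?nnegrE ?normr_ge0 ?(ltW e0)//.
by rewrite sqr_l2_norm; exact: le_lt_trans (dot_le_sqsum fg) r2e.
Qed.

Lemma l2_separable : separable (l2 C).
Proof.
exists (range (fun s : seq nat => l2_of_seq (map d s))).
  by apply: sub_countable (card_image_le _ _) _; exact: countableP.
move=> O [f Of] oO.
have [e /= e0 feO] : exists2 e : C, 0 < e & ball f e `<=` O.
  by apply/nbhs_ballP; exact: open_nbhs_nbhs.
have [s fs] := l2_of_seq_dense f e0.
by exists (l2_of_seq (map d s)); split; [apply: feO; rewrite -ball_normE|exists s].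
Qed.

Definition parity_seq b (s : seq C) : seq C :=
  mkseq (fun k => if odd k == b then nth 0 s k else 0) (size s).

Lemma nth_parity_seq b s k :
  nth 0 (parity_seq b s) k = if odd k == b then nth 0 s k else 0.
Proof.
have [ks|sk] := ltnP k (size s); first by rewrite nth_mkseq.
by rewrite nth_default ?size_mkseq// nth_default// if_same.
Qed.

Lemma parity_subspace_parity_seq b s :
  parity_subspace b (l2_of_seq (parity_seq b s)).
Proof. by move=> k kb; rewrite /= nth_parity_seq (negbTE kb). Qed.

(** Passing to [parity_seq] only zeroes coordinates at which [f] vanishes, so no coordinate error
    grows. *)
Lemma parity_seq_dist b f s : parity_subspace b f ->
  `|f - l2_of_seq (parity_seq b s)| <= `|f - l2_of_seq s|.
Proof.
move=> fb; apply: norm_le_sqsum => // n.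
apply: le_trans (sqsum_le_norm _ n); apply: ler_sum => k _.
rewrite -[X in `|X| ^+ 2 <= _]/(f k - nth 0 (parity_seq b s) k).
rewrite -[X in _ <= `|X| ^+ 2]/(f k - nth 0 s k).
rewrite nth_parity_seq; case: eqP => // /eqP kb.
by rewrite fb// subr0 normr0 expr0n exprn_ge0.
Qed.

Lemma l2_jump_hypercyclic b :
  subspace_hypercyclic (l2_jump b) (parity_subspace b).
Proof.
(* An index codes a finite sequence with a dummy number, so that every sequence recurs at
   arbitrarily large indices; invalid codes give the empty sequence. *)
pose code k : seq nat * nat := odflt ([::], 0%N) (unpickle k).
pose y k := l2_of_seq (parity_seq b (map d (code k).1)).
apply: (@subspace_hypercyclic_criterion C (l2 C) half_pow_small
  (l2_jump b) (quarter \*: l2_jump (~~ b)) (parity_subspace b) _ _ _ _ _ y).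
- exact: l2_jump_bounded.
- exact: parity_subspace_closed.
- exact: l2_jumpN_stable.
- exact: l2_jumpK.
- by move=> f fb; rewrite -(l2_jumpN_norm fb).
- by move=> k; exact: parity_subspace_parity_seq.
- move=> k; exists (size (code k).1); apply: l2_jump_nilpotent.
    exact: parity_subspace_parity_seq.
  by move=> j kj; rewrite /= nth_default// size_mkseq size_map.
- move=> f e K fb e0; have [s fs] := l2_of_seq_dense f e0.
  have [m Km] := @injective_unbounded (fun m => pickle (s, m)) K
    (fun m1 m2 eq_m => congr1 snd (pcan_inj pickleK eq_m)).
  exists (pickle (s, m)) => //; rewrite /y /code pickleK /=.
  exact: le_lt_trans (parity_seq_dist _ fb) fs.
Qed.

Theorem l2_subspace_hypercyclic_pair :
  exists (H : completeNormedModType C) (ip : {dot H for Num.conj})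
         (T Tstar : {linear H -> H}) (M1 M2 : set H),
    [/\ hilbert_dot ip /\ separable H,
        bounded_operator T,
        bounded_operator Tstar /\ is_adjoint ip T Tstar,
        nontrivial_closed_subspace M1 /\ nontrivial_closed_subspace M2 &
        subspace_hypercyclic T M1 /\ subspace_hypercyclic Tstar M2].
Proof.
(* [l2_jump true] is [l2_jump (~~ false)], the adjoint of [l2_jump false]. *)
exists (l2 C), l2_dot, (l2_jump false), (l2_jump true).
exists (parity_subspace false), (parity_subspace true); split.
- by split; [move=> f; rewrite sqr_l2_norm|exact: l2_separable].
- exact: l2_jump_bounded.
- by split; [exact: l2_jump_bounded|exact: l2_jump_adjoint].
- by split; exact: parity_subspace_nontrivial.
- by split; exact: l2_jump_hypercyclic.
Qed.

End SquareSummableHilbert.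

(** * The field [R[i]] *)

Section ComplexField.
Variable R : realType.
Local Open Scope complex_scope.
Local Notation C := (R[i] : numClosedFieldType).
Local Notation Re := (@complex.Re R).
Local Notation Im := (@complex.Im R).

Lemma norm_complexi : `|'i%C| = 1 :> R[i].
Proof. by rewrite normc_def /= expr0n expr1n add0r sqrtr1. Qed.

(** Multiplication by ['i] keeps the modulus and turns the imaginary part into a real part, up to
    sign. *)
Lemma normc_ge_Im (z : R[i]) : `|Im z|%:C <= `|z|.
Proof.
by have := normc_ge_Re (z * 'i); rewrite ReiNIm normrN normrM norm_complexi mulr1.
Qed.

Lemma normc_le_ReD (z : R[i]) : `|z| <= (`|Re z| + `|Im z|)%:C.
Proof.
rewrite [in leLHS](complexE z) rmorphD /=; apply: (le_trans (ler_normD _ _)).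
by rewrite normrM norm_complexi mul1r !normc_def /= !expr0n /= !addr0 !sqrtr_sqr.
Qed.

(** Positive elements of [R[i]] are real, so every epsilon can be treated as a real number. *)
Lemma complex_gt0E (e : R[i]) : 0 < e -> e = (Re e)%:C /\ 0 < Re e.
Proof. by case: e => a b; rewrite ltcE /= => /andP[/eqP-> ->]. Qed.

Lemma complex_cvg (T : Type) (F : set_system T) {FF : Filter F}
    (u : T -> C) (a b : R) :
  Re (u x) @[x --> F] --> a -> Im (u x) @[x --> F] --> b ->
  u x @[x --> F] --> (a +i* b : C).
Proof.
move=> ua ub; apply/cvgrPdist_lt => e /complex_gt0E[-> e0].
set r := Re _ in e0 *; have r2 : 0 < r / 2 by rewrite divr_gt0.
move/cvgrPdist_lt : ua => /(_ _ r2) ua; move/cvgrPdist_lt : ub => /(_ _ r2) ub.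
apply: (filterS2 _ _ ua ub) => x ax bx.
apply: (le_lt_trans (normc_le_ReD _)); rewrite ltcR [ltRHS]splitr.
by case: (u x) ax bx => c d /= ax bx; rewrite ltrD.
Qed.

Lemma complex_complete (F : set_system C) : ProperFilter F -> cauchy F -> cvg F.
Proof.
move=> FF Fc.
have Fcauchy (e : R) : 0 < e -> \forall x & y \near F, `|x - y| < e%:C :> C.
  move=> e0; have e0' : 0 < e%:C :> C by rewrite (ltcR 0).
  by move/cauchy_ballP : Fc => /(_ _ e0'); rewrite -ball_normE.
have Rec : cvg (Re x @[x --> F]).
  apply: R_complete; apply/cauchy_ballP => e e0; rewrite -ball_normE.
  rewrite !near_simpl near_map2; apply: (filterS _ (Fcauchy _ e0)) => -[x y] /=.
  rewrite -(ltcR _ e); apply: le_lt_trans; apply: le_trans (normc_ge_Re (x - y)).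
  by rewrite raddfB.
have Imc : cvg (Im x @[x --> F]).
  apply: R_complete; apply/cauchy_ballP => e e0; rewrite -ball_normE.
  rewrite !near_simpl near_map2; apply: (filterS _ (Fcauchy _ e0)) => -[x y] /=.
  rewrite -(ltcR _ e); apply: le_lt_trans; apply: le_trans (normc_ge_Im (x - y)).
  by rewrite raddfB.
have := complex_cvg Rec Imc.
by move=> h; apply/cvg_ex; eexists; exact: h.
Qed.

(** Nonnegativity confines the sequence to the real axis, where bounded monotone sequences
    converge. *)
Lemma complex_monotone_cvg (u : nat -> C) : (forall n, 0 <= u n) ->
  (forall n, u n <= u n.+1) -> (exists M, forall n, u n <= M) -> cvgn u.
Proof.
move=> u0 und [M uM].
have Imu n : Im (u n) = 0 by exact/ger0_Im/u0.
have Reu : cvg (Re (u n) @[n --> \oo]).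
  apply: nondecreasing_is_cvgn.
    apply: homo_leq => // [? ? ?|n]; first exact: le_trans.
    by have := und n; rewrite lecE => /andP[].
  by exists (Re M) => _ [n _ <-]; have := uM n; rewrite lecE => /andP[].
apply/cvg_ex; exists (lim (Re (u n) @[n --> \oo]) +i* 0); apply: complex_cvg => //.
by under eq_cvg do rewrite Imu; exact: cvg_cst.
Qed.

Lemma complex_half_pow_small (e : C) : 0 < e -> exists n, 2^-1 ^+ n < e.
Proof.
move=> /complex_gt0E[-> e0].
have [n ne] : exists n, (2^-1 : R) ^+ n < Re e.
  (* This [n] exceeds the inverse of [Re e], and [n < 2 ^ n]. *)
  exists (Num.bound (Re e)^-1).
  rewrite exprVn invf_plt ?posrE ?exprn_gt0//.
  apply: (lt_le_trans (archi_boundP (ltW _))); first by rewrite invr_gt0.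
  by rewrite -natrX ler_nat ltnW// ltn_expl.
by exists n; move: ne; rewrite -ltcR rmorphXn fmorphV rmorph_nat.
Qed.

Lemma complex_dense_seq :
  exists d : nat -> C, forall z e, 0 < e -> exists n, `|z - d n| < e.
Proof.
(* Complex numbers with rational parts are enumerated by decoding pairs of rationals; invalid codes
   give [0]. *)
pose q n : rat * rat := odflt (0, 0) (unpickle n).
exists (fun n => ratr (q n).1 +i* ratr (q n).2) => z e /complex_gt0E[-> e0].
set r := Re e in e0 *; have r2 : 0 < r / 2 by rewrite divr_gt0.
have approx (x : R) : exists s : rat, `|x - ratr s| < r / 2.
  have xr : x - r / 2 < x + r / 2 by rewrite ltrBlDr -addrA ltrDl addr_gt0.
  have [s] := rat_in_itvoo xr.
  rewrite in_itv /= => xs; exists s; rewrite distrC ltr_distl//.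
have [[s1 zs1] [s2 zs2]] := (approx (Re z), approx (Im z)).
exists (pickle (s1, s2)); rewrite /q pickleK /=.
apply: (le_lt_trans (normc_le_ReD _)).
rewrite ltcR [ltRHS]splitr.
case: z zs1 zs2 => a b /= zs1 zs2; rewrite ltrD//.
Qed.

End ComplexField.

Theorem mainTheorem7 (R : realType) :
  exists (H : completeNormedModType R[i]) (ip : {dot H for Num.conj})
         (T Tstar : {linear H -> H}) (M1 M2 : set H),
    [/\ hilbert_dot ip /\ separable H,
        bounded_operator T,
        bounded_operator Tstar /\ is_adjoint ip T Tstar,
        nontrivial_closed_subspace M1 /\ nontrivial_closed_subspace M2 &
        subspace_hypercyclic T M1 /\ subspace_hypercyclic Tstar M2].
Proof.
have [d d_dense] := complex_dense_seq R.
exact: (l2_subspace_hypercyclic_pair (@complex_monotone_cvg R)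
  (@complex_complete R) (@complex_half_pow_small R) d_dense).
Qed.
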